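(* Let $F$ be an infinite field and let $A$ be a finite-dimensional associative $F$-algebra (not assumed commutative, and not assumed to have an identity element). Let $AA=\{xy : x\in A,\ y\in A\}$ and let $Z$ be the set of all right zero divisors of $A$. (i) If $AA\neq A$, then $Z=A$, and hence $A$ is right tame. (ii) If $AA=A$, then $Z$ is the union of all maximal left ideals of $A$. Further, $A$ is right proper tame if and only if $A$ possesses at most finitely many maximal left ideals.
   Context: An $F$-algebra $A$ is an $F$-vector space with a bilinear multiplication $A\times A\to A$, satisfying $f(xy)=(fx)y=x(fy)$ for all $f\in F$, $x,y\in A$; it is associative if $(xy)z=x(yz)$ for all $x,y,z\in A$. $AA$ is the set of all products $xy$ (not the span of the products). A left ideal of $A$ is a subring $I$ of $A$ (an additive subgroup closed under multiplication; not assumed to be closed under scalar multiplication by $F$, and no identity is required) such that $a\in A$, $x\in I$ implies $ax\in I$. A left ideal $I\neq A$ is maximal if whenever $J$ is a left ideal with $I\subset J\subset A$ (inclusions not necessarily strict), then $J=I$ or $J=A$. An element $z\in A$ is a right zero divisor if there exists a nonzero $w\in A$ with $wz=0$ (so $z=0$ is allowed). $Z$ denotes the set of all right zero divisors. $A$ is right tame if $Z$ is the union of at most finitely many linear subspaces of $A$ ($F$-subspaces). $A$ is right proper tame if $A$ is right tame and, additionally, $Z\neq A$. *)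

(* Defs.v *)
From HB Require Import structures.
From mathcomp Require Import all_boot all_algebra.
From mathcomp Require Import boolp classical_sets functions cardinality.

Set Implicit Arguments.
Unset Strict Implicit.
Unset Printing Implicit Defensive.

Import GRing.Theory.

Local Open Scope ring_scope.
Local Open Scope classical_set_scope.

(* The algebra structures of MathComp all require an identity element. Here a
   finite-dimensional F-algebra is a vectType A over F with a bilinear
   multiplication mul; associativity is assumed separately. *)

Section Algebra.
Variables (F : fieldType) (A : vectType F) (mul : {bilinear A -> A -> A}).

(* AA: the set of products, not its linear span *)
Definition products : set A := [set mul x y | x in [set: A] & y in [set: A]].

Definition right_zero_divisor (z : A) : Prop :=
  exists2 w : A, w != 0 & mul w z = 0.

Definition right_zero_divisors : set A := [set z | right_zero_divisor z].

(* Closure under scalar multiplication by F is not required. *)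
Record subring (I : set A) : Prop := Subring {
  subring0 : I 0;
  subringB : forall x y, I x -> I y -> I (x - y);
  subringM : forall x y, I x -> I y -> I (mul x y)
}.

Definition left_ideal (I : set A) : Prop :=
  subring I /\ forall a x, I x -> I (mul a x).

Definition maximal_left_ideal (I : set A) : Prop :=
  [/\ left_ideal I, I <> [set: A] &
      forall J : set A, left_ideal J -> I `<=` J -> J = I \/ J = [set: A]].

(* The empty union is allowed; it occurs exactly when A is the zero algebra,
   where no nonzero w exists and so there is no right zero divisor. *)
Definition right_tame : Prop :=
  exists S : set {vspace A},
    finite_set S /\ right_zero_divisors = \bigcup_(U in S) [set` U].

Definition right_proper_tame : Prop :=
  right_tame /\ right_zero_divisors <> [set: A].

End Algebra.

(* Main.v *)
Require Import Defs.
From HB Require Import structures.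
From mathcomp Require Import all_boot all_algebra.
From mathcomp Require Import boolp classical_sets functions cardinality.

(**
  The central device is the residual of a left ideal I, the set of all y with
  A y contained in I. It is again a left ideal, it contains I, and it is always
  a linear subspace, because a (c y) = (c a) y (lemma residual_vspace). When
  AA = A, the residual of a proper left ideal is still proper
  (residual_proper). Two things follow for AA = A. A maximal left ideal equals
  its residual, so it is a linear subspace even though left ideals are only
  required to be additive (maximal_left_ideal_vspace). And every proper left
  ideal lies in a maximal one (exists_maximal_left_ideal): a proper left ideal
  that is a subspace of largest dimension cannot be enlarged to any proper left
  ideal, as the residual of the larger one would be a proper subspace.

  In finite dimension, z is not a right zero divisor exactly when right
  multiplication by z is onto, that is, A z = A. If such a z exists then
  AA = A, which is part (i). Let now AA = A. If z is a right zero divisor, then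
  A z is a proper left ideal, and a maximal left ideal M above A z is its own
  residual, so z lies in M. Conversely an ideal that contains some z with
  A z = A is all of A. So Z is the union of the maximal left ideals.

  The equivalence in (ii) rests on the fact that, over an infinite field, a
  subspace covered by finitely many subspaces is contained in one of them
  (vspace_sub_finite_cover). Finitely many maximal left ideals, which are
  proper subspaces, hence form a tame Z different from A. If conversely Z is a
  finite union of subspaces and Z is not A, each maximal left ideal lies in one
  of these subspaces, and no two of them lie in the same one U: their sum would
  be A, contained in U and so in Z.
*)

Local Open Scope ring_scope.
Local Open Scope classical_set_scope.

Import GRing.Theory.

(** * Subspaces and finite covers *)

Section Subspaces.
Set Implicit Arguments.
Unset Strict Implicit.
Variables (F : fieldType) (A : vectType F).
Implicit Types (U V W : {vspace A}) (P : set A).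

Lemma exists_maximal_vspace (Q : {vspace A} -> Prop) U : Q U ->
  exists2 M : {vspace A}, Q M & forall V, Q V -> (M <= V)%VS -> V = M.
Proof.
move=> QU.
pose D n := `[< exists2 V, Q V & \dim V = n >].
have exD : exists n, D n by exists (\dim U); apply/asboolP; exists U.
have ubD n : D n -> (n <= \dim {:A})%N.
  by move/asboolP=> [V _ <-]; exact/dimvS/subvf.
case: (ex_maxnP exD ubD) => n /asboolP[M QM <-] maxM.
exists M => // V QV MV; apply/esym/eqP; rewrite eqEdim MV.
by apply: maxM; apply/asboolP; exists V.
Qed.

(** A subspace of P of largest dimension is all of P, since adjoining a vector of
    P to it stays within P. *)
Lemma linear_set_vspace P : P 0 ->
    (forall c x y, P x -> P y -> P (c *: x + y)) ->
  exists U, P = [set` U].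
Proof.
move=> P0 PD.
have [|U UP maxU] := @exists_maximal_vspace (fun V => [set` V] `<=` P) 0%VS.
  by move=> x /=; rewrite memv0 => /eqP->.
exists U; apply/seteqP; split=> // x Px.
have UxP : [set` (<[x]> + U)%VS] `<=` P.
  by move=> _ /memv_addP[_ /vlineP[c ->] [u /UP Pu ->]]; exact: PD.
rewrite /= -(maxU _ UxP (addvSr _ _)).
exact: subvP (addvSl _ _) _ (memv_line x).
Qed.

(** By induction on s, one may assume that V is neither contained in the first
    subspace U nor covered by the others. Pick v in V outside U and w in V outside
    all the others, so that w is in U. No point of the line v + F w lies in U,
    hence infinitely many of them share one of the finitely many other subspaces,
    which then contains w. *)
Lemma vspace_sub_cover V (s : seq {vspace A}) : infinite_set [set: F] ->
    (forall v, v \in V -> has (fun U => v \in U) s) ->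
  exists2 U, U \in s & (V <= U)%VS.
Proof.
move=> infF; elim: s => [|U s IHs] covV; first by have := covV 0 (mem0v V).
have [VU|/subvPn[v Vv vU]] := boolP (V <= U)%VS.
  by exists U; rewrite // mem_head.
have [covs|] := pselect (forall w, w \in V -> has (fun W => w \in W) s).
  by have [W sW VW] := IHs covs; exists W; rewrite // in_cons sW orbT.
move/existsNP=> [w /not_implyP[Vw /negP ws]].
have Uw : w \in U by have := covV w Vw; rewrite /= (negbTE ws) orbF.
have line_s c : has (fun W => v + c *: w \in W) s.
  have Vl : v + c *: w \in V by rewrite memvD // memvZ.
  have := covV _ Vl; rewrite /= => /orP[Ul|//].
  by move: vU; rewrite -(addrK (c *: w) v) memvB // memvZ.
(* The index in s of a subspace containing v + c w is injective in c. *)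
pose idx c := find (fun W => v + c *: w \in W) s.
have idxI : injective idx.
  move=> c d eq_cd; apply/eqP/negPn/negP; rewrite -subr_eq0 => cd0.
  set W := nth 0%VS s (idx c).
  have Wc : v + c *: w \in W by exact: nth_find (line_s c).
  have Wd : v + d *: w \in W by rewrite /W eq_cd; exact: nth_find (line_s d).
  have sW : W \in s by rewrite mem_nth // -has_find.
  case/negP: ws; apply/hasP; exists W => //.
  have := memvB Wc Wd; rewrite opprD addrACA subrr add0r -scalerBl.
  by move/(memvZ (c - d)^-1); rewrite scalerA mulVf // scale1r.
exfalso; apply: infF.
apply: (@sub_finite_set _ _ (idx @^-1` `I_(size s))).
  by move=> c _ /=; rewrite /idx -has_find.
by apply: finite_preimage => // c d _ _; exact: idxI.
Qed.

Lemma vspace_sub_finite_cover V (S : set {vspace A}) : infinite_set [set: F] ->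
    finite_set S -> [set` V] `<=` \bigcup_(U in S) [set` U] ->
  exists2 U, S U & (V <= U)%VS.
Proof.
move=> infF /finite_seqP[s ->] covV.
have [v Vv|U sU VU] := @vspace_sub_cover V s infF; last by exists U.
by have [U sU Uv] := covV v Vv; apply/hasP; exists U.
Qed.

End Subspaces.

(** * Left ideals and one-sided multiplication *)

Section LeftIdeals.
Set Implicit Arguments.
Unset Strict Implicit.
Variables (F : fieldType) (A : vectType F) (mul : {bilinear A -> A -> A}).
Hypothesis mulA : associative mul.
Implicit Types (I J : set A) (U V M : {vspace A}).

Lemma left_idealP I :
  left_ideal mul I <->
  [/\ I 0, forall x y, I x -> I y -> I (x - y) & forall a x, I x -> I (mul a x)].
Proof.
split=> [[[I0 IB _] IM] | [I0 IB IM]]; first by [].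
by split=> //; split=> // x y _; exact: IM.
Qed.

Lemma left_idealD I x y : left_ideal mul I -> I x -> I y -> I (x + y).
Proof.
move=> /left_idealP[I0 IB _] Ix Iy; rewrite -[y]opprK -[- y]add0r.
exact: IB Ix (IB _ _ I0 Iy).
Qed.

Definition principal_left_ideal z : set A := [set mul a z | a in [set: A]].

Lemma left_ideal_principal z : left_ideal mul (principal_left_ideal z).
Proof.
apply/left_idealP; split.
- by exists 0; rewrite // linear0l.
- by move=> _ _ [a _ <-] [b _ <-]; exists (a - b); rewrite // linearBl.
- by move=> a _ [b _ <-]; exists (mul a b); rewrite // -mulA.
Qed.

(** A z is the image and the left annihilator of z the kernel of the linear map
    x |-> x z, so this is the rank-nullity theorem. *)
Lemma not_right_zero_divisor z :
  ~ right_zero_divisor mul z <-> principal_left_ideal z = [set: A].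
Proof.
pose R : 'End(A) := linfun (applyr mul z).
have RE x : R x = mul x z by rewrite lfunE.
split=> [nz_z|Az [w w0 wz]].
  have kerR : lker R == 0%VS.
    rewrite -subv0; apply/subvP => w; rewrite memv_ker RE memv0 => /eqP wz.
    by apply/negPn/negP => w0; apply: nz_z; exists w.
  apply/seteqP; split=> // y _; exists ((R^-1)%VF y) => //.
  by rewrite -RE lker0_lfunVK.
have limR : limg R = fullv.
  apply/eqP; rewrite eqEsubv subvf; apply/subvP => y _.
  have [x _ <-] : principal_left_ideal z y by rewrite Az.
  by rewrite -RE memv_img ?memvf.
have := limg_ker_dim R fullv; rewrite limR capfv => /eqP.
rewrite -[X in _ == X]add0n eqn_add2r dimv_eq0 => /eqP kerR.
have : w \in lker R by rewrite memv_ker RE wz.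
by rewrite kerR memv0 (negbTE w0).
Qed.

(** * Residuals *)

Definition residual I : set A := [set y | forall a, I (mul a y)].

Lemma sub_residual I : left_ideal mul I -> I `<=` residual I.
Proof. by move=> /left_idealP[_ _ IM] x Ix a; exact: IM. Qed.

Lemma left_ideal_residual I : left_ideal mul I -> left_ideal mul (residual I).
Proof.
move=> /left_idealP[I0 IB IM]; apply/left_idealP; split.
- by move=> a; rewrite linear0r.
- by move=> x y Ix Iy a; rewrite linearBr; exact: IB.
- by move=> b x Ix a; rewrite mulA; exact: Ix.
Qed.

(** Closure under scalars comes from a (c y) = (c a) y: the scalar is absorbed by
    the left factor, which ranges over all of A. *)
Lemma residual_vspace I : left_ideal mul I -> exists U, residual I = [set` U].
Proof.
move=> idI; apply: linear_set_vspace => [a|c x y Ix Iy a].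
  by rewrite linear0r; have /left_idealP[] := idI.
by rewrite linearPr -linearZl_LR; exact: left_idealD.
Qed.

(** * Maximal left ideals and right zero divisors *)

Section Idempotent.
Hypothesis AA : products mul = [set: A].

(** Every x is a product a b; if b is in the residual of I, then x is in I. *)
Lemma residual_proper I : I <> [set: A] -> residual I <> [set: A].
Proof.
move=> properI resI; apply: properI; apply/seteqP; split=> // x _.
have [a _ [b _ <-]] : products mul x by rewrite AA.
by have : residual I b by rewrite resI.
Qed.

Lemma residual_maximal I : maximal_left_ideal mul I -> residual I = I.
Proof.
case=> idI properI maxI.
have [//|] := maxI _ (left_ideal_residual idI) (sub_residual idI).
by move/(residual_proper properI).
Qed.

Lemma maximal_left_ideal_vspace I :
  maximal_left_ideal mul I -> exists U, I = [set` U].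
Proof.
move=> maxI; rewrite -(residual_maximal maxI).
by case: maxI => idI _ _; exact: residual_vspace.
Qed.

(** Largest dimension among the linear proper left ideals suffices: a proper left
    ideal above such an M has a residual that is linear, proper and above M. *)
Lemma exists_maximal_left_ideal I : left_ideal mul I -> I <> [set: A] ->
  exists2 M, maximal_left_ideal mul M & I `<=` M.
Proof.
move=> idI properI.
pose Q U := [/\ left_ideal mul [set` U], [set` U] <> [set: A] & I `<=` [set` U]].
have residQ J : left_ideal mul J -> J <> [set: A] -> I `<=` J ->
    exists2 U : {vspace A}, residual J = [set` U] & Q U.
  move=> idJ properJ IJ; have [U resJ] := residual_vspace idJ.
  exists U => //; rewrite /Q -resJ; split.
  - exact: left_ideal_residual.
  - exact: residual_proper.
  - exact: subset_trans IJ (sub_residual idJ).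
have [U0 _ QU0] := residQ I idI properI (@subset_refl _ I).
have [M [idM properM IM] maxM] := exists_maximal_vspace QU0.
exists [set` M] => //; split=> // J idJ MJ.
have [->|properJ] := pselect (J = [set: A]); [by right | left].
have [U resJ QU] := residQ J idJ properJ (subset_trans IM MJ).
have JU : J `<=` [set` U] by rewrite -resJ; exact: sub_residual.
have UM : U = M by apply: maxM => //; apply/subvP => x /MJ /JU.
by apply/seteqP; split=> //; rewrite -UM.
Qed.

(** If z is a right zero divisor and M is a maximal left ideal above A z, then z
    lies in the residual of M, which is M. *)
Lemma right_zero_divisorsE :
  right_zero_divisors mul = \bigcup_(I in maximal_left_ideal mul) I.
Proof.
apply/seteqP; split=> [z zZ|z [I [/left_idealP[_ _ IM] properI _] Iz]].
  have properAz : principal_left_ideal z <> [set: A].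
    by move=> /not_right_zero_divisor; apply.
  have [M maxM AzM] :=
    exists_maximal_left_ideal (left_ideal_principal z) properAz.
  exists M => //; rewrite -(residual_maximal maxM) => a.
  by apply: AzM; exists a.
apply: contrapT => /not_right_zero_divisor Az; apply: properI.
apply/seteqP; split=> // y _.
by have [a _ <-] : principal_left_ideal z y; [rewrite Az | exact: IM].
Qed.

(** The sum I + J is a left ideal contained in U, so it is proper; being above
    both I and J, it equals both by maximality. *)
Lemma maximal_left_ideal_sub_vspace I J U :
    maximal_left_ideal mul I -> maximal_left_ideal mul J ->
    I `<=` [set` U] -> J `<=` [set` U] -> [set` U] <> [set: A] ->
  I = J.
Proof.
move=> [idI properI maxI] [idJ properJ maxJ] IU JU properU.
have [I0 IB IM] := (left_idealP I).1 idI; have [J0 JB JM] := (left_idealP J).1 idJ.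
pose K : set A := [set x + y | x in I & y in J].
have idK : left_ideal mul K.
  apply/left_idealP; split.
  - by exists 0 => //; exists 0; rewrite // addr0.
  - move=> _ _ [x Ix [y Jy <-]] [x' Ix' [y' Jy' <-]].
    exists (x - x'); first exact: IB.
    by exists (y - y'); [exact: JB | rewrite opprD addrACA].
  - move=> a _ [x Ix [y Jy <-]]; exists (mul a x); first exact: IM.
    by exists (mul a y); [exact: JM | rewrite linearDr].
have KU : K `<=` [set` U].
  by move=> _ [x /IU Ux [y /JU Uy <-]]; exact: memvD.
have properK : K <> [set: A].
  by move=> KT; apply: properU; apply/seteqP; split=> // x _; apply: KU; rewrite KT.
have IK : I `<=` K by move=> x Ix; exists x => //; exists 0; rewrite // addr0.
have JK : J `<=` K by move=> y Jy; exists 0 => //; exists y; rewrite // add0r.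
have [KI|//] := maxI K idK IK; have [KJ|//] := maxJ K idK JK.
by rewrite -KI KJ.
Qed.

Lemma right_proper_tame_iff : infinite_set [set: F] ->
  right_proper_tame mul <-> finite_set (maximal_left_ideal mul).
Proof.
move=> infF; split=> [[[S [finS ZS]] properZ] | finMax].
  pose above (U : {vspace A}) I := [set` U] <> [set: A] /\ I `<=` [set` U].
  have exU I : maximal_left_ideal mul I -> exists2 U, S U & above U I.
    move=> maxI; have [V IV] := maximal_left_ideal_vspace maxI.
    have IZ : [set` V] `<=` \bigcup_(U in S) [set` U].
      by rewrite -ZS right_zero_divisorsE -IV; exact: bigcup_sup.
    have [U SU VU] := vspace_sub_finite_cover infF finS IZ.
    exists U => //; split; last by rewrite IV => x; exact: subvP.
    move=> UT; apply: properZ; apply/seteqP; split=> // x _.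
    by rewrite ZS; exists U => //; rewrite UT.
  (* The maximal left ideals below a given U in S form a subsingleton. *)
  pose below (U : {vspace A}) := maximal_left_ideal mul `&` above U.
  apply: (@sub_finite_set _ _ (\bigcup_(U in S) below U)).
    by move=> I maxI; have [U SU UI] := exU I maxI; exists U.
  apply: bigcup_finite => // U _.
  have [[I [maxI [properU IU]]]|none] := pselect (exists I, below U I).
    apply: sub_finite_set (finite_set1 I) => J [maxJ [_ JU]].
    exact: maximal_left_ideal_sub_vspace JU IU properU.
  by apply: sub_finite_set (@finite_set0 _) => I bI; apply: none; exists I.
pose S : set {vspace A} := [set U | maximal_left_ideal mul [set` U]].
have ZS : right_zero_divisors mul = \bigcup_(U in S) [set` U].
  rewrite right_zero_divisorsE; apply/seteqP; split=> x [I maxI Ix].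
    have [U IU] := maximal_left_ideal_vspace maxI.
    by subst I; exists U.
  by exists [set` I].
have finS : finite_set S.
  apply: (finite_preimage (f := fun U : {vspace A} => [set` U])) => //.
  by move=> U V _ _ /seteqP[UV VU]; apply/vspaceP => x; apply/idP/idP;
    [exact: UV | exact: VU].
split; first by exists S.
rewrite ZS => coverA.
have [|U [_ properU _] fullU] := @vspace_sub_finite_cover _ _ fullv S infF finS.
  by rewrite coverA.
by apply: properU; apply/seteqP; split=> // x _; apply: (subvP fullU) (memvf x).
Qed.

End Idempotent.

Lemma right_zero_divisors_full :
  products mul <> [set: A] -> right_zero_divisors mul = [set: A].
Proof.
move=> AA; apply/seteqP; split=> // z _.
apply: contrapT => /not_right_zero_divisor Az; apply: AA.
apply/seteqP; split=> // y _.
have [a _ <-] : principal_left_ideal z y by rewrite Az.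
by exists a => //; exists z.
Qed.

End LeftIdeals.

Theorem mainTheorem1 (F : fieldType) (A : vectType F)
    (mul : {bilinear A -> A -> A}) :
  infinite_set [set: F] ->
  associative mul ->
  (products mul <> [set: A] ->
     right_zero_divisors mul = [set: A] /\ right_tame mul) /\
  (products mul = [set: A] ->
     right_zero_divisors mul = \bigcup_(I in maximal_left_ideal mul) I /\
     (right_proper_tame mul <-> finite_set (maximal_left_ideal mul))).
Proof.
move=> infF mulA; split=> AA.
  have ZA := right_zero_divisors_full AA; split=> //.
  exists [set fullv]; split; first exact: finite_set1.
  by rewrite ZA bigcup_set1; apply/seteqP; split=> // x _; exact: memvf.
split; first exact: right_zero_divisorsE.
exact: right_proper_tame_iff.
Qed.
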